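(* Let $M$ be a simple matroid of rank $3$ on a ground set $E$ of size $n$. For $m\ge 2$ let $t_m$ be the number of flats $F$ of $M$ of rank $2$ and of size $m$. Then the Chern numbers of $M$ are $$\overline{c}_1^2(M)=9-5n+\sum_{m\geq2}(3m-4)t_m,$$ $$\overline{c}_2(M)=3-2n+\sum_{m\geq 2}(m-1)t_m.$$
   Context: Matroid notions. For a matroid $M$ with rank function $r$ on a finite set $E$, a flat is a subset $F\subseteq E$ with $r(F\cup\{j\})>r(F)$ for all $j\in E\setminus F$; a loop is an element $i$ with $r(\{i\})=0$; distinct $i,j$ are parallel if $r(\{i,j\})=1$. $M$ is simple if it has neither loops nor parallel points. For $S\subseteq E$, $M|S$ is the restriction to $S$, and $M/S$ is the contraction, on $E\setminus S$, with rank function $T\mapsto r(T\cup S)-r(S)$. The beta invariant is $\beta(M)=(-1)^{r(E)}\sum_{S\subseteq E}(-1)^{|S|}r(S)$. Bergman fan. Let $M$ be a loopless matroid of rank $d+1$ on $E$ (here $d=2$). Let $N=\mathbb{Z}^E/\mathbb{Z}\mathbf{1}$ with $\mathbf 1=\sum_{i\in E}e_i$, let $u_i$ be the image of $e_i$ in $N$ and $u_S=\sum_{i\in S}u_i$. The Bergman fan $\Sigma_M$ is the pure $d$-dimensional fan in $N\otimes\mathbb{R}$ with cones $\sigma_{\mathcal F}=\mathrm{Cone}(u_{F_1},\dots,u_{F_k})$ for each chain of flats $\mathcal F:\emptyset\subsetneq F_1\subsetneq\cdots\subsetneq F_k\subsetneq E$. Minkowski weights. $MW_k(\Sigma_M)$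 is the group of integer-valued functions $\omega$ on the $k$-dimensional cones of $\Sigma_M$ satisfying the balancing condition: for every $(k-1)$-dimensional cone $\tau$, $\sum_{F}\omega(\tau+\mathbb{R}_{\ge 0}u_F)\,u_F\in \mathrm{span}(\tau)$, the sum running over flats $F$ such that $\tau+\mathbb{R}_{\ge0}u_F$ is a $k$-dimensional cone of $\Sigma_M$. Product: let $A^*(M)=\mathbb{Z}[x_F: F \text{ a nonempty proper flat}]/(I+J)$, where $I$ is generated by the $x_Fx_G$ with $F,G$ incomparable and $J$ by $\sum_{F\ni i}x_F-\sum_{F\ni j}x_F$ for $i,j\in E$, and let $\deg:A^d(M)\to\mathbb{Z}$ be the isomorphism with $\deg(x_{F_1}\cdots x_{F_d})=1$ for every maximal chain $\emptyset\subsetneq F_1\subsetneq\cdots\subsetneq F_d\subsetneq E$. For each $k$ the map $A^{d-k}(M)\to MW_k(\Sigma_M)$ sending $a$ to $\sigma_{\mathcal F}\mapsto \deg(a\,x_{F_1}\cdots x_{F_k})$ is an isomorphism, and the product $MW_k(\Sigma_M)\times MW_l(\Sigma_M)\to MW_{k+l-d}(\Sigma_M)$ is the one transported from $A^*(M)$. The isomorphism $\mathrm{w}:MW_0(\Sigma_M)\to\mathbb{Z}$ returns the weight of the vertex. CSM cycles. For $0\le k\le d$, $\mathrm{csm}_k(M)\in MW_k(\Sigma_M)$ is the Minkowski weight given by $\omega(\sigma_{\mathcal F})=(-1)^{d-k}\prod_{i=0}^k\beta(M|F_{i+1}/F_i)$ for a chain $\mathcal F:\emptyset=F_0\subsetneq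 F_1\subsetneq\cdots\subsetneq F_k\subsetneq F_{k+1}=E$. Chern numbers. For $M$ of rank $3$ (so $d=2$), the Chern numbers are $\overline c_1^2(M)=\mathrm{w}(\mathrm{csm}_1(M)\cdot\mathrm{csm}_1(M))$ and $\overline c_2(M)=\mathrm{w}(\mathrm{csm}_0(M))$. *)

(* Defs.v *)
From HB Require Import structures.
From mathcomp Require Import all_boot all_order all_algebra ring_quotient.
From mathcomp Require Import boolp Rstruct.
From mathcomp Require classical_sets.
From mathcomp Require Import mpoly.

Set Implicit Arguments.
Unset Strict Implicit.
Unset Printing Implicit Defensive.

Import GRing.Theory.
Local Open Scope ring_scope.

(** * Matroids *)

(* The ground set is a subset of a finite type T, so that restrictions and
   contractions live over the same T.  The values of [rk] outside the ground
   set are irrelevant. *)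
Record matroid (T : finType) := Matroid {
  ground : {set T};
  rk : {set T} -> nat;
  rk_card : forall A : {set T}, A \subset ground -> (rk A <= #|A|)%N;
  rk_mono : forall A B : {set T},
    A \subset B -> B \subset ground -> (rk A <= rk B)%N;
  rk_submod : forall A B : {set T}, A \subset ground -> B \subset ground ->
    (rk (A :|: B) + rk (A :&: B) <= rk A + rk B)%N }.

Section Minors.
Variables (T : finType) (M : matroid T) (S : {set T}).

Lemma restrict_card (A : {set T}) :
  A \subset S :&: ground M -> (rk M A <= #|A|)%N.
Proof. by rewrite subsetI => /andP[_ AE]; exact: rk_card. Qed.

Lemma restrict_mono (A B : {set T}) :
  A \subset B -> B \subset S :&: ground M -> (rk M A <= rk M B)%N.
Proof. by move=> AB; rewrite subsetI => /andP[_ BE]; exact: rk_mono. Qed.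

Lemma restrict_submod (A B : {set T}) :
  A \subset S :&: ground M -> B \subset S :&: ground M ->
  (rk M (A :|: B) + rk M (A :&: B) <= rk M A + rk M B)%N.
Proof.
by rewrite !subsetI => /andP[_ AE] /andP[_ BE]; exact: rk_submod.
Qed.

(* M|S; meant for S contained in the ground set. *)
Definition restrict : matroid T :=
  Matroid restrict_card restrict_mono restrict_submod.

Let S' := S :&: ground M.

Definition contract_rk (A : {set T}) : nat := rk M (A :|: S') - rk M S'.

Let S'E : S' \subset ground M. Proof. exact: subsetIr. Qed.

Let sub_ground (A : {set T}) :
  A \subset ground M :\: S -> A :|: S' \subset ground M.
Proof.
by move=> AE; rewrite subUset S'E (subset_trans AE) ?subsetDl.
Qed.

Let S'_le (A : {set T}) :
  A \subset ground M :\: S -> (rk M S' <= rk M (A :|: S'))%N.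
Proof. by move=> AE; apply: rk_mono; rewrite ?subsetUr ?sub_ground. Qed.

Lemma contract_card (A : {set T}) :
  A \subset ground M :\: S -> (contract_rk A <= #|A|)%N.
Proof.
move=> AE; rewrite /contract_rk leq_subLR addnC.
have AE' : A \subset ground M by apply: subset_trans AE (subsetDl _ _).
apply: leq_trans (leq_add (rk_card AE') (leqnn _)).
by apply: leq_trans (rk_submod AE' S'E); exact: leq_addr.
Qed.

Lemma contract_mono (A B : {set T}) :
  A \subset B -> B \subset ground M :\: S ->
  (contract_rk A <= contract_rk B)%N.
Proof.
by move=> AB BE; apply: leq_sub2r; apply: rk_mono; rewrite ?setSU ?sub_ground.
Qed.

Lemma contract_submod (A B : {set T}) :
  A \subset ground M :\: S -> B \subset ground M :\: S ->
  (contract_rk (A :|: B) + contract_rk (A :&: B)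
     <= contract_rk A + contract_rk B)%N.
Proof.
move=> AE BE; rewrite /contract_rk.
have ABE : A :|: B \subset ground M :\: S by rewrite subUset AE.
have IE : A :&: B \subset ground M :\: S := subset_trans (subsetIl _ _) AE.
have := rk_submod (sub_ground AE) (sub_ground BE).
rewrite -setUUl -setUIl => h.
by rewrite !addnBA ?S'_le // !addnBAC ?S'_le // !leq_sub2r.
Qed.

(* M/S; meant for S contained in the ground set. *)
Definition contract : matroid T :=
  Matroid contract_card contract_mono contract_submod.

End Minors.

Section MatroidNotions.
Variables (T : finType) (M : matroid T).

Definition rank : nat := rk M (ground M).

Definition is_flat (F : {set T}) : bool :=
  (F \subset ground M) &&
  [forall j in ground M :\: F, (rk M F < rk M (j |: F))%N].

Definition loop (i : T) : bool := (i \in ground M) && (rk M [set i] == 0%N).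

Definition parallel (i j : T) : bool :=
  [&& i \in ground M, j \in ground M, i != j & rk M [set i; j] == 1%N].

Definition simple : Prop :=
  (forall i, ~~ loop i) /\ (forall i j, ~~ parallel i j).

Definition beta : int :=
  (-1) ^+ rank *
  \sum_(S : {set T} | S \subset ground M) (-1) ^+ #|S| * (rk M S)%:Z.

(* The number t_m of rank 2 flats of size m. *)
Definition num_lines (m : nat) : nat :=
  #|[set F : {set T} | [&& is_flat F, rk M F == 2%N & #|F| == m]]|.

(* The dimension d of the Bergman fan. *)
Definition fan_dim : nat := rank.-1.

Definition is_proper_flat (F : {set T}) : bool :=
  [&& is_flat F, F != set0 & F != ground M].

Definition pflat : finType := {F : {set T} | is_proper_flat F}.

Definition comparable_flats (F G : pflat) : bool :=
  (val F \subset val G) || (val G \subset val F).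

(** * Bergman fan and Minkowski weights *)

(* The k-dimensional cones sigma_F of the Bergman fan are in bijection with the
   chains of k nonempty proper flats, and are represented by the (unordered)
   sets of members of these chains. *)
Definition is_cone (k : nat) (C : {set pflat}) : bool :=
  (#|C| == k) && [forall F in C, forall G in C, comparable_flats F G].

Definition cone (k : nat) : finType := {C : {set pflat} | is_cone k C}.

Local Notation R := Rdefinitions.R.

(* Lift of u_S to R^T.  Working in N (x) R = R^E / R 1, with E the ground set
   of M, amounts to working in R^T modulo the line of [uvec (ground M)], since
   all the vectors below are supported on E. *)
Definition uvec (S : {set T}) : {ffun T -> R^o} := [ffun e => (e \in S)%:R].

Definition cone_span (C : {set pflat}) : {vspace {ffun T -> R^o}} :=
  (<<[seq uvec (val F) | F <- enum C]>> + <[uvec (ground M)]>)%VS.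

(* The (unique, when it exists) cone s in the inner sum is tau + R_{>=0} u_F. *)
Definition boundary (k : nat) (w : {ffun cone k -> int}) (C : {set pflat}) :
    {ffun T -> R^o} :=
  \sum_(F : pflat) \sum_(s : cone k | val s == F |: C)
     (w s)%:~R *: uvec (val F).

(* The balancing condition is imposed at all the cones of dimension k - 1;
   there are none when k = 0. *)
Definition balanced (k : nat) : pred {ffun cone k -> int} :=
  fun w => [forall C : {set pflat},
    ((0 < k)%N && is_cone k.-1 C) ==> (boundary w C \in cone_span C)].

Lemma balanced_zmod_closed k : zmod_closed (@balanced k).
Proof.
split=> [|v w /forallP bv /forallP bw]; apply/forallP=> C; apply/implyP=> hC.
  rewrite /boundary big1 ?mem0v // => F _; rewrite big1 // => s _.
  by rewrite ffunE scale0r.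
have -> : boundary (v - w) C = boundary v C - boundary w C.
  rewrite /boundary -sumrB; apply: eq_bigr => F _.
  rewrite -sumrB; apply: eq_bigr => s _.
  by rewrite !ffunE rmorphB scalerBl.
by apply: rpredB; [apply: (implyP (bv C)) | apply: (implyP (bw C))].
Qed.

HB.instance Definition _ k :=
  GRing.isZmodClosed.Build {ffun cone k -> int} (@balanced k)
    (balanced_zmod_closed k).

Record MW (k : nat) := MinkowskiWeight {
  weight :> {ffun cone k -> int};
  _ : balanced weight }.

HB.instance Definition _ k := [isSub for @weight k].
HB.instance Definition _ k := [Choice of MW k by <:].
HB.instance Definition _ k := [SubChoice_isSubZmodule of MW k by <:].

Lemma is_cone0 : is_cone 0 set0.
Proof.
by rewrite /is_cone cards0 eqxx; apply/forall_inP => F; rewrite inE.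
Qed.

Definition vertex : cone 0 := exist _ set0 is_cone0.

(* The isomorphism w : MW_0 -> Z. *)
Definition mw_value (w : MW 0) : int := w vertex.

(** * The Chow ring *)

Definition chow_poly := {mpoly int[#|{: pflat}|]}.

Definition xvar (F : pflat) : chow_poly := 'X_(enum_rank F).

Definition linear_rel (i j : T) : chow_poly :=
  \sum_(F : pflat | i \in val F) xvar F - \sum_(F : pflat | j \in val F) xvar F.

(* The ideal I + J. *)
Definition chow_ideal : pred chow_poly := fun p => `[<
  exists (a : pflat -> pflat -> chow_poly) (b : T -> T -> chow_poly),
    p = \sum_(F : pflat) \sum_(G : pflat | ~~ comparable_flats F G)
          a F G * (xvar F * xvar G)
        + \sum_(i in ground M) \sum_(j in ground M) b i j * linear_rel i j >].

Lemma chow_idealr_closed : idealr_closed chow_ideal.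
Proof.
split.
- apply/asboolP; exists (fun _ _ => 0), (fun _ _ => 0).
  rewrite !big1 ?addr0 // => i _; rewrite big1 // => j _; exact: mul0r.
- apply/asboolP => -[a [b]] /(congr1 (meval (fun=> 0))).
  have x0 F : meval (fun=> 0) (xvar F) = 0 :> int by rewrite mevalXU.
  have l0 i j : meval (fun=> 0) (linear_rel i j) = 0 :> int.
    rewrite mevalB 2!(raddf_sum (meval (fun=> 0 : int))).
    by rewrite !big1 ?subrr // => F _; exact: x0.
  rewrite meval1 mevalD 2!(raddf_sum (meval (fun=> 0 : int))) !big1 ?addr0.
  + by move/eqP; rewrite oner_eq0.
  + move=> i _; rewrite raddf_sum big1 // => j _.
    by rewrite /= mevalM l0 mulr0.
  + move=> F _; rewrite raddf_sum big1 // => G _.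
    by rewrite /= mevalM mevalM !x0 !mulr0.
- move=> c p q /asboolP[a [b ->]] /asboolP[a' [b' ->]]; apply/asboolP.
  exists (fun F G => c * a F G + a' F G), (fun i j => c * b i j + b' i j).
  rewrite mulrDr addrACA; congr (_ + _); rewrite mulr_sumr -big_split /=;
    apply: eq_bigr => i _; rewrite mulr_sumr -big_split /=;
    by apply: eq_bigr => j _; rewrite mulrDl -mulrA.
Qed.

HB.instance Definition _ :=
  isIdealr.Build chow_poly chow_ideal chow_idealr_closed.

Definition chow := {ideal_quot (chow_ideal : idealr chow_poly)}.
HB.instance Definition _ := GRing.ComNzRing.on chow.

Definition chow_class (p : chow_poly) : chow := (\pi_chow p)%qT.

(* The graded piece A^k(M). *)
Definition chow_gr (k : nat) : pred chow :=
  fun a => `[< exists2 p : chow_poly, p \is k.-homog & a = chow_class p >].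

(* The monomial x_{F_1} ... x_{F_k}. *)
Definition chow_mon (C : {set pflat}) : chow :=
  chow_class (\prod_(F in C) xvar F).

(* f restricts to a group isomorphism A^d(M) -> Z that is 1 on the monomials of
   maximal chains; its values outside of A^d(M) are irrelevant. *)
Definition is_degree_map (f : chow -> int) : Prop :=
  [/\ {in chow_gr fan_dim &, {morph f : a b / a + b}},
      {in chow_gr fan_dim &, injective f},
      (forall z : int, exists2 a, a \in chow_gr fan_dim & f a = z) &
      (forall s : cone fan_dim, f (chow_mon (val s)) = 1)].

Definition deg : chow -> int :=
  classical_sets.xget (fun=> 0) is_degree_map.

(** * Products of Minkowski weights *)

(* The weight sigma_F |-> deg (a x_{F_1} ... x_{F_k}), for a in A^{d-k}(M). *)
Definition chow_weight (k : nat) (a : chow) : {ffun cone k -> int} :=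
  [ffun s : cone k => deg (a * chow_mon (val s))].

(* The inverse of the isomorphism A^{d-k}(M) -> MW_k. *)
Definition mw_class (k : nat) (w : MW k) : chow :=
  classical_sets.xget 0 (fun a : chow =>
    a \in chow_gr (fan_dim - k) /\ chow_weight k a = weight w).

(* The product MW_k x MW_l -> MW_m, only meaningful for m = k + l - d.  The
   default value 0 is then not used, because the image of A^{d-m}(M) consists of
   balanced weights. *)
Definition mw_mul (k l m : nat) (v : MW k) (w : MW l) : MW m :=
  insubd 0 (chow_weight m (mw_class v * mw_class w)).

(** * CSM cycles and Chern numbers *)

(* The sequence F_1, ..., F_k of members of a chain, in increasing order. *)
Definition chain_seq (C : {set pflat}) : seq {set T} :=
  sort (fun A B : {set T} => A \subset B) [seq val F | F <- enum C].

End MatroidNotions.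

Section Chern.
Variables (T : finType) (M : matroid T).

(* The pairs p are the (F_i, F_{i+1}) for 0 <= i <= k. *)
Definition csm_weight (k : nat) : {ffun cone M k -> int} :=
  [ffun s : cone M k => (-1) ^+ (fan_dim M - k) *
    \prod_(p <- zip (set0 :: chain_seq (val s))
                    (rcons (chain_seq (val s)) (ground M)))
      beta (contract (restrict M p.2) p.1)].

(* The default value 0 is not used for loopless M and k <= d, because
   [csm_weight k] is then balanced. *)
Definition csm (k : nat) : MW M k := insubd 0 (csm_weight k).

(* Only meaningful for d = 2, where csm_1 . csm_1 lies in MW_{1+1-2}. *)
Definition chern_c1_sq : int := mw_value (mw_mul 0 (csm 1) (csm 1)).

Definition chern_c2 : int := mw_value (csm 0).

End Chern.

(* Main.v *)
(** On [A^2(M)], the monomials [x_F x_G] are all integer multiples of the class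
    of a flag, the coefficient being an explicit symmetric form on flats.  The
    form kills the linear relations, so its apolar pairing with polynomials
    descends to the quotient and shows that the class of a flag has no torsion:
    this is the degree map.  With [k_i] the number of lines through [i], the
    weights of [csm_1] are [2 - k_i] on points and [2 - |L|] on lines, and are
    represented by
    [sum_i x_i + sum_L 2 (|L| - 1) x_L + (3 - 2n) sum_(F contains e) x_F],
    whose square is computed by pairing its coefficients with these weights.
    Beta invariants come from writing the corank as a combination of indicators
    of [S \subset F], where [F] runs over flats. *)

From HB Require Import structures.
Require Import Defs.
From mathcomp Require Import all_boot all_order all_algebra ring_quotient.
From mathcomp Require Import boolp Rstruct.
From mathcomp Require classical_sets.
From mathcomp Require Import mpoly.
From mathcomp Require Import zify ring.

Set Implicit Arguments.
Unset Strict Implicit.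
Unset Printing Implicit Defensive.

Import GRing.Theory.
Local Open Scope ring_scope.

(** * Beta invariants of minors of a simple matroid of rank 3 *)

Section SignedSums.
Variable T : finType.

(** If [A] contains some [x], the subsets without [x] are matched with those containing it by adding
    [x]; this flips the sign, so the terms cancel in pairs. *)
Lemma sum_sign_subset (A : {set T}) :
  \sum_(S : {set T} | S \subset A) (-1) ^+ #|S| = (A == set0)%:R :> int.
Proof.
have [->|[x xA]] := set_0Vmem A.
  under eq_bigl do rewrite subset0.
  by rewrite big_pred1_eq cards0 eqxx.
have -> : A == set0 = false by apply/negP => /eqP A0; rewrite A0 inE in xA.
rewrite (bigID (fun S : {set T} => x \in S)) /=.
rewrite (reindex_onto (fun S => x |: S) (fun S => S :\ x)) /=; last first.
  by move=> S /andP[_ xS]; rewrite setD1K.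
rewrite (eq_bigl (fun S : {set T} => (S \subset A) && (x \notin S))); last first.
  move=> S; rewrite setU11 andbT subUset sub1set xA /=.
  case xS: (x \in S); last by rewrite setU1K ?xS // eqxx.
  rewrite andbF; apply/negP => /andP[_ /eqP SE].
  by move: xS; rewrite -SE !inE eqxx.
rewrite -big_split big1 //= => S /andP[_ xS].
by rewrite cardsU1 xS exprS mulN1r addNr.
Qed.

(* The decomposition writes the corank as a combination of the indicators of
   the lower sets [S \subset A i]; only [S = set0] has a nonzero signed sum. *)
Lemma beta_decomposition (M : matroid T) (I : finType) (P : pred I)
    (A : I -> {set T}) (c : I -> int) (c0 : int) :
  ground M != set0 ->
  (forall i, P i -> A i \subset ground M) ->
  (forall i, P i -> A i != set0) ->
  (forall S : {set T}, S \subset ground M ->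
     (rank M)%:Z - (rk M S)%:Z
       = \sum_(i | P i) c i * (S \subset A i)%:R + c0 * (S == set0)%:R) ->
  beta M = (-1) ^+ (rank M).+1 * c0.
Proof.
move=> G0 AG A0 dec.
rewrite /beta exprS mulN1r mulNr -mulrN; congr (_ * _).
have sum_ind (B : {set T}) : B \subset ground M ->
    \sum_(S : {set T} | S \subset ground M) (-1) ^+ #|S| * (S \subset B)%:R
      = (B == set0)%:R :> int.
  move=> BG; rewrite -sum_sign_subset big_mkcond /= [RHS]big_mkcond /=.
  apply: eq_bigr => S _; case SB: (S \subset B); last by rewrite mulr0 if_same.
  by rewrite mulr1 (subset_trans SB BG).
(* The rank is traded for the corank: the constant part has signed sum zero because the ground set
   is nonempty. *)
rewrite (eq_bigr (fun S : {set T} => (rank M)%:Z * (-1) ^+ #|S|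
   - (-1) ^+ #|S| * ((rank M)%:Z - (rk M S)%:Z))); last by move=> S _; ring.
rewrite sumrB -mulr_sumr sum_sign_subset (negbTE G0) mulr0 sub0r.
congr (- _).
under eq_bigr => S SG do rewrite (dec S SG) mulrDr mulr_sumr.
rewrite big_split /= exchange_big /= big1 ?add0r.
  under eq_bigr do rewrite mulrCA -subset0.
  by rewrite -mulr_sumr sum_ind ?sub0set // eqxx mulr1.
move=> i Pi; under eq_bigr do rewrite mulrCA.
by rewrite -mulr_sumr sum_ind ?AG // (negbTE (A0 _ Pi)) mulr0.
Qed.

End SignedSums.

Section RankThree.
Variables (T : finType) (M : matroid T).
Hypotheses (M_simple : simple M) (M_rank : rank M = 3%N).
Local Notation E := (ground M).

(** * Points and lines of a simple matroid of rank 3 *)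

Definition line (L : {set T}) : bool := is_flat M L && (rk M L == 2%N).

Lemma rk_set0 : rk M set0 = 0%N.
Proof. by apply/eqP; rewrite -leqn0 -(cards0 T) rk_card ?sub0set. Qed.

Lemma rk_point i : i \in E -> rk M [set i] = 1%N.
Proof.
move=> iE; case: M_simple => /(_ i) nl _.
have := @rk_card T M [set i]; rewrite sub1set cards1 => /(_ iE).
by move: nl; rewrite /loop iE /=; case: (rk M [set i]) => [|[|]].
Qed.

Lemma rk_pair i j : i \in E -> j \in E -> i != j -> rk M [set i; j] = 2%N.
Proof.
move=> iE jE ij; case: M_simple => _ /(_ i j).
rewrite /parallel iE jE ij /= => np.
have sE : [set i; j] \subset E by rewrite subUset !sub1set iE.
have := rk_card sE; rewrite cards2 ij.
have : (rk M [set i] <= rk M [set i; j])%N by apply: rk_mono; rewrite ?subsetUl.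
by rewrite rk_point //; case: (rk M _) np => [|[|[|]]].
Qed.

Lemma rk_le3 (A : {set T}) : A \subset E -> (rk M A <= 3)%N.
Proof. by rewrite -M_rank => AE; exact: rk_mono. Qed.

Lemma rk_ge2 (A : {set T}) i j : A \subset E -> i \in A -> j \in A -> i != j ->
  (2 <= rk M A)%N.
Proof.
move=> AE iA jA ij; rewrite -(@rk_pair i j) ?(subsetP AE) //.
by apply: rk_mono; rewrite ?subUset ?sub1set ?iA.
Qed.

Lemma lineE L : line L -> L \subset E.
Proof. by case/andP => /andP[]. Qed.

Lemma rk_line L : line L -> rk M L = 2%N.
Proof. by case/andP => _ /eqP. Qed.

Lemma line_card L : line L -> (2 <= #|L|)%N.
Proof. by move=> lL; rewrite -(rk_line lL) rk_card ?lineE. Qed.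

Lemma line_neq0 L : line L -> L != set0.
Proof. by move=> /line_card; rewrite -card_gt0; exact: ltnW. Qed.

Lemma line_point L i : line L -> (L == [set i]) = false.
Proof.
by move=> /line_card lL; apply/negP => /eqP LE; rewrite LE cards1 in lL.
Qed.

Lemma line_subset_point L i : line L -> (L \subset [set i]) = false.
Proof.
by move=> lL; rewrite subset1 line_point //= (negbTE (line_neq0 lL)).
Qed.

Lemma line_flat L x : line L -> x \in E -> x \notin L -> (2 < rk M (x |: L))%N.
Proof.
move=> /andP[/andP[_ /forall_inP fl] /eqP r2] xE xL.
by rewrite -r2 fl // inE xL.
Qed.

(** A set that is maximal among those of rank 2 containing [A] is a flat, since adding a point must
    change its rank. *)
Lemma line_through (A : {set T}) : A \subset E -> rk M A = 2%N ->
  exists2 L, line L & A \subset L.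
Proof.
move=> AE A2.
have /maxset_exists[L /maxsetP[/andP[LE /eqP L2] maxL] AL] :
  [pred S : {set T} | (S \subset E) && (rk M S == 2%N)] A by rewrite /= AE A2.
exists L => //; rewrite /line /is_flat LE L2 /= andbT.
apply/forall_inP => j; rewrite inE => /andP[jL jE].
have jLE : j |: L \subset E by rewrite subUset sub1set jE.
have le : (rk M L <= rk M (j |: L))%N by apply: rk_mono; rewrite ?subsetUr.
rewrite L2 in le; rewrite ltn_neqAle le andbT; apply/negP => /eqP r2.
have := maxL (j |: L); rewrite /= jLE -r2 /= => /(_ isT (subsetUr _ _)) eL.
by move: jL; rewrite -eL setU11.
Qed.

(** The intersection has rank at least 2, so submodularity bounds the rank of the union by 2. A
    point of one line outside the other would raise that rank to 3. *)
Lemma line_eq L L' i j : line L -> line L' -> i != j ->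
  i \in L -> j \in L -> i \in L' -> j \in L' -> L = L'.
Proof.
move=> lL lL' ij iL jL iL' jL'.
have r2 : (rk M (L :|: L') <= 2)%N.
  have := rk_submod (lineE lL) (lineE lL').
  rewrite (rk_line lL) (rk_line lL').
  suff : (2 <= rk M (L :&: L'))%N by clear M_rank; lia.
  apply: (@rk_ge2 _ i j); rewrite ?inE ?iL ?jL //.
  exact: subset_trans (subsetIl _ _) (lineE lL).
have UE : L :|: L' \subset E by rewrite subUset !lineE.
apply/eqP; rewrite eqEsubset; apply/andP; split; apply/subsetP => x xX;
  apply/negPn/negP => xn.
- have := line_flat lL' (subsetP (lineE lL) _ xX) xn.
  rewrite ltnNge => /negP; apply; apply: leq_trans r2; apply: rk_mono => //.
  by rewrite subUset sub1set subsetUr inE xX.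
- have := line_flat lL (subsetP (lineE lL') _ xX) xn.
  rewrite ltnNge => /negP; apply; apply: leq_trans r2; apply: rk_mono => //.
  by rewrite subUset sub1set subsetUl inE xX orbT.
Qed.

Lemma line_join i j : i \in E -> j \in E -> i != j ->
  exists2 L, line L & (i \in L) && (j \in L).
Proof.
move=> iE jE ij.
have [||L lL] := @line_through [set i; j].
- by rewrite subUset !sub1set iE.
- exact: rk_pair.
- by rewrite subUset !sub1set; exists L.
Qed.

Lemma line_second_point L i : line L -> exists2 j, j \in L & j != i.
Proof.
move=> /line_card lL; have : (0 < #|L :\ i|)%N.
  rewrite -ltnS; apply: leq_trans lL _.
  by rewrite (cardsD1 i L) -[X in (_ <= X)%N]add1n leq_add2r leq_b1.
by case/card_gt0P => j; rewrite !inE => /andP[? ?]; exists j.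
Qed.

Lemma line_point_off L : line L -> exists2 j, j \in E & j \notin L.
Proof.
move=> lL; suff : E :\: L != set0.
  by case/set0Pn => j; rewrite inE => /andP[? ?]; exists j.
rewrite setD_eq0; apply/negP => EL.
by have := rk_mono EL (lineE lL); rewrite (rk_line lL) -/(rank M) M_rank.
Qed.

Lemma ground_neq0 : E != set0.
Proof. by apply/eqP => E0; move: M_rank; rewrite /rank E0 rk_set0. Qed.

Lemma point_proper i : i \in E -> is_proper_flat M [set i].
Proof.
move=> iE; apply/and3P; split.
- rewrite /is_flat sub1set iE; apply/forall_inP => j.
  by rewrite !inE => /andP[ji jE]; rewrite rk_point // rk_pair.
- by apply/set0Pn; exists i; rewrite inE.
- by apply/eqP => iEq; move: M_rank; rewrite /rank -iEq rk_point.
Qed.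

Lemma line_proper L : line L -> is_proper_flat M L.
Proof.
move=> lL; apply/and3P; split; [by case/andP: lL|exact: line_neq0|].
by apply/eqP => LE; move: M_rank; rewrite /rank -LE rk_line.
Qed.

(** A flat with two distinct points has rank at least 2; a point outside it raises the rank, which
    stays at most 3, so the rank is exactly 2. *)
Lemma proper_flatP A : is_proper_flat M A ->
  (exists2 i, i \in E & A = [set i]) \/ line A.
Proof.
case/and3P => fA /set0Pn[x xA] AnE; have /andP[AE /forall_inP fl] := fA.
have [Ax|] := boolP (A \subset [set x]).
  by left; exists x; [exact: (subsetP AE)|apply/eqP; rewrite eqEsubset Ax sub1set].
case/subsetPn => y yA; rewrite inE => yx; right; rewrite /line fA /=.
have := rk_ge2 AE yA xA yx; have := rk_le3 AE.
have : E :\: A != set0.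
  by rewrite setD_eq0; apply: contra AnE => EA; rewrite eqEsubset AE.
case/set0Pn => j jA; have := fl j jA.
suff /rk_le3 : j |: A \subset E by lia.
by rewrite subUset sub1set AE andbT; move: jA; rewrite inE => /andP[].
Qed.

Lemma is_proper_flatE A :
  is_proper_flat M A = [exists i in E, A == [set i]] || line A.
Proof.
apply/idP/orP => [/proper_flatP[[i iE ->]|->]|[/exists_inP[i iE /eqP ->]|]].
- by left; apply/exists_inP; exists i.
- by right.
- exact: point_proper.
- exact: line_proper.
Qed.

Lemma sum_pflat (V : nmodType) (g : {set T} -> V) :
  \sum_(F : pflat M) g (val F)
    = \sum_(i in E) g [set i] + \sum_(L | line L) g L.
Proof.
rewrite -(big_sub (is_proper_flat M) g) /=.
rewrite (bigID line) /= addrC; congr (_ + _).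
- rewrite -(@big_imset _ _ _ _ _ (@set1 T) (mem E) g) /=; last first.
    by move=> i j _ _; exact: set1_inj.
  apply: eq_bigl => A; rewrite /in_mem /= is_proper_flatE andb_orl andbN orbF.
  apply/andP/imsetP => [[/exists_inP[i iE /eqP ->] _]|[i iE ->]]; first by exists i.
  split; first by apply/exists_inP; exists i.
  by apply/negP => /(@line_point _ i); rewrite eqxx.
- apply: eq_bigl => A; rewrite /in_mem /= is_proper_flatE.
  by case: (line A); rewrite ?orbT ?andbF.
Qed.

(** The number k_i of lines through [i], written as a sum of indicators so that double counting is
    an exchange of sums. *)
Definition pencil (i : T) : int := \sum_(L | line L) (i \in L)%:R.

(** With two distinct points, [S] has rank 2 and lies on exactly one line, or has rank 3 and lies on
    none. The count is thus the corank, which makes lines the right lower sets for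
    [beta_decomposition]. *)
Lemma sum_lines_above (S : {set T}) i j :
  S \subset E -> i \in S -> j \in S -> i != j ->
  \sum_(L | line L) (S \subset L)%:R = 3 - (rk M S)%:Z.
Proof.
move=> SE iS jS ij; have r2 := rk_ge2 SE iS jS ij; have := rk_le3 SE.
rewrite leq_eqVlt => /orP[/eqP r3|].
  rewrite r3 big1 // => L lL; case: (boolP (S \subset L)) => // SL.
  by have := rk_mono SL (lineE lL); rewrite r3 rk_line.
rewrite ltnS => r2'; have S2 : rk M S = 2%N by lia.
have [L lL SL] := line_through SE S2.
rewrite S2 (bigD1 L) //= SL big1 ?addr0 // => L' /andP[lL' neq].
case: (boolP (S \subset L')) => // SL'; case/negP: neq.
by rewrite (@line_eq L' L i j) ?(subsetP SL) ?(subsetP SL').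
Qed.

Lemma sum_lines_pair i j : i \in E -> j \in E -> i != j ->
  \sum_(L | line L) ((i \in L) && (j \in L))%:R = 1 :> int.
Proof.
move=> iE jE ij; under eq_bigr do rewrite -!sub1set -subUset.
rewrite (@sum_lines_above _ i j) ?rk_pair ?set21 ?set22 //.
by rewrite subUset !sub1set iE.
Qed.

(** * Beta invariants of the minors occurring in the CSM cycles *)

Lemma beta_minor (F G : {set T}) (I : finType) (P : pred I)
    (A : I -> {set T}) (c : I -> int) (c0 : int) :
  F \subset E -> G \proper F ->
  (forall i, P i -> A i \subset F :\: G) ->
  (forall i, P i -> A i != set0) ->
  (forall S : {set T}, S \subset F :\: G ->
     (rk M F)%:Z - (rk M (S :|: G))%:Z
       = \sum_(i | P i) c i * (S \subset A i)%:R + c0 * (S == set0)%:R) ->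
  beta (contract (restrict M F) G) = (-1) ^+ (rk M F - rk M G).+1 * c0.
Proof.
move=> FE GF AG A0 dec; have GF' := proper_sub GF.
have FE' : F :&: E = F by apply/setIidPl.
have GFE : G :&: (F :&: E) = G by rewrite FE'; apply/setIidPl.
have gr : ground (contract (restrict M F) G) = F :\: G by rewrite /= FE'.
have rkS S : rk (contract (restrict M F) G) S = (rk M (S :|: G) - rk M G)%N.
  by rewrite /= /contract_rk /= GFE.
have rankE : rank (contract (restrict M F) G) = (rk M F - rk M G)%N.
  rewrite /rank gr rkS; congr (rk M _ - _)%N; apply/setP => x; rewrite !inE.
  by case xG: (x \in G); rewrite ?orbF //= (subsetP GF').
rewrite -rankE; apply: (beta_decomposition (P := P) (A := A) (c := c));
  rewrite ?gr //.
  by rewrite setD_eq0; case/properP: GF => _ [x xF xG]; apply/subsetPn; exists x.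
move=> S SF; rewrite -dec // rankE rkS.
(* Ranks of the minor are truncated differences; passing to integers uses rk G <= rk (S U G) <= rk
   F. *)
have SGF : S :|: G \subset F.
  by rewrite subUset GF' andbT (subset_trans SF) ?subsetDl.
have := @rk_mono T M G (S :|: G) (subsetUr _ _) (subset_trans SGF FE).
by have := rk_mono SGF FE; clear M_simple M_rank; lia.
Qed.

(** The corank identities below are checked along these cases: points contain only sets of the first
    two kinds, and sets of the third kind are governed by the line through [i] and [j]. *)
Lemma subset_cases (S : {set T}) :
  [\/ S = set0, exists i, S = [set i] |
      exists i j, [/\ i \in S, j \in S & i != j]].
Proof.
have [->|[x xS]] := set_0Vmem S; first by constructor 1.
have [Sx|/subsetPn[y yS]] := boolP (S \subset [set x]).
  by constructor 2; exists x; apply/eqP; rewrite eqEsubset Sx sub1set.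
by rewrite inE => yx; constructor 3; exists y, x.
Qed.

(** In such a minor of rank 1 the corank is 1 at [set0] and 0 elsewhere, so the decomposition holds
    with an empty family of lower sets. *)
Lemma beta_rk1 (F G : {set T}) : F \subset E -> G \proper F ->
  rk M F = (rk M G).+1 ->
  (forall S : {set T}, S \subset F :\: G -> S != set0 ->
     rk M (S :|: G) = rk M F) ->
  beta (contract (restrict M F) G) = 1.
Proof.
move=> FE GF rF rS.
rewrite (beta_minor (P := pred0) (A := fun _ : 'I_0 => set0)
           (c := fun=> 0) (c0 := 1)) // ?rF ?subSnn //.
move=> S SF; rewrite big_pred0_eq add0r mul1r; case: eqVneq => [->|S0].
  by rewrite set0U; lia.
by rewrite rS // rF; lia.
Qed.

Lemma beta_point i : i \in E -> beta (contract (restrict M [set i]) set0) = 1.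
Proof.
move=> iE; apply: beta_rk1; rewrite ?sub1set ?rk_set0 ?rk_point //.
  by rewrite proper0; apply/set0Pn; exists i; rewrite inE.
move=> S; rewrite setD0 setU0 subset1 => /orP[/eqP ->|->] //.
by rewrite rk_point.
Qed.

Lemma beta_contract_line L : line L -> beta (contract (restrict M E) L) = 1.
Proof.
move=> lL; apply: beta_rk1; rewrite // -?/(rank M) ?M_rank ?(rk_line lL) //.
  by rewrite properE lineE //=; have [j jE jL] := line_point_off lL;
    apply/subsetPn; exists j.
move=> S SE /set0Pn[x xS]; have := subsetP SE _ xS.
rewrite inE => /andP[xL xE]; have := line_flat lL xE xL.
have SLE : S :|: L \subset E.
  by rewrite subUset (lineE lL) andbT (subset_trans SE) ?subsetDl.
have : (rk M (x |: L) <= rk M (S :|: L))%N.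
  by apply: rk_mono => //; rewrite setSU // sub1set.
by have := rk_le3 SLE; lia.
Qed.

(** On subsets of a line the corank is the sum of the indicators of its points, corrected by 2 - |L|
    at [set0]. *)
Lemma beta_line L : line L ->
  beta (contract (restrict M L) set0) = #|L|%:Z - 2.
Proof.
move=> lL; have LE := lineE lL.
rewrite (beta_minor (P := fun i => i \in L) (A := @set1 T)
           (c := fun=> 1) (c0 := 2 - #|L|%:Z)) //.
- by rewrite (rk_line lL) rk_set0 subn0 -signr_odd expr1 mulN1r opprB.
- by rewrite proper0 line_neq0.
- by move=> i iL; rewrite setD0 sub1set.
- by move=> i _; apply/set0Pn; exists i; rewrite inE.
move=> S; rewrite setD0 setU0 (rk_line lL) => SL.
under eq_bigr do rewrite mul1r.
case: (subset_cases S) SL => [->|[i ->]|[i [j [iS jS ij]]]] SL.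
- rewrite rk_set0 eqxx mulr1; under eq_bigr do rewrite sub0set.
  by rewrite sumr_const mulr1n natz; ring.
- rewrite sub1set in SL; rewrite rk_point ?(subsetP LE) //.
  rewrite (bigD1 i) //= subxx big1 => [|k /andP[_ ki]].
    by rewrite -subset0 sub1set inE mulr0.
  by rewrite sub1set inE eq_sym (negbTE ki).
- have -> : S == set0 = false by apply/eqP => S0; rewrite S0 inE in iS.
  rewrite big1 => [|k _].
    have SE := subset_trans SL LE.
    by have := rk_mono SL LE; rewrite (rk_line lL);
       have := rk_ge2 SE iS jS ij; clear M_rank; lia.
  case: (boolP (S \subset [set k])) => // /subsetP Sk.
  have := Sk _ iS; have := Sk _ jS; rewrite !inE => /eqP jk /eqP ik.
  by rewrite ik jk eqxx in ij.
Qed.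

(** The contraction has rank 2, and its rank 1 flats are the lines through [i] with [i] removed. The
    argument for a line applies with these flats in place of points. *)
Lemma beta_contract_point i : i \in E ->
  beta (contract (restrict M E) [set i]) = pencil i - 2.
Proof.
move=> iE; have := ground_neq0.
rewrite (beta_minor (P := fun L => line L && (i \in L)) (A := fun L => L :\ i)
           (c := fun=> 1) (c0 := 2 - pencil i)) //.
- move=> _; rewrite -/(rank M) M_rank rk_point // subSS subn0.
  by rewrite -signr_odd expr1 mulN1r opprB.
- have := point_proper iE; case/and3P => _ _; rewrite properE sub1set iE /=.
  by rewrite eqEsubset sub1set iE.
- by move=> L /andP[lL _]; apply: setSD; exact: lineE.
- move=> L /andP[/(@line_second_point _ i)[j jL ji] _].
  by apply/set0Pn; exists j; rewrite !inE ji.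
move=> S SE; under eq_bigr do rewrite mul1r.
rewrite -/(rank M) M_rank.
have SiE : i |: S \subset E.
  by rewrite subUset sub1set iE (subset_trans SE) ?subsetDl.
have pE : pencil i = \sum_(L | line L && (i \in L)) 1.
  by rewrite /pencil [RHS]big_mkcondr /=; apply: eq_bigr => L _; case: ifP.
have [->|[x xS]] := set_0Vmem S.
  rewrite set0U rk_point // eqxx mulr1 pE.
  by rewrite [in RHS](eq_bigr (fun=> 1)) => [|L _]; [ring|rewrite sub0set].
have -> : S == set0 = false by apply/eqP => S0; rewrite S0 inE in xS.
rewrite mulr0 addr0 setUC.
have := subsetP SE _ xS; rewrite !inE => /andP[xi xE].
rewrite -(@sum_lines_above _ x i) ?inE ?xS ?eqxx ?orbT //.
rewrite [RHS]big_mkcondr /=; apply: eq_bigr => L _; rewrite subUset sub1set.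
case: (i \in L) => //=; congr (_%:R); congr nat_of_bool.
apply/idP/idP => [SL|SL]; last by apply: subset_trans SL (subsetDl _ _).
apply/subsetP => y yS; have := subsetP SE _ yS; rewrite !inE => /andP[-> _] /=.
exact: (subsetP SL).
Qed.

(** Both sides count the incident pairs of a point and a line. *)
Lemma sum_pencil : \sum_(i in E) pencil i = \sum_(L | line L) #|L|%:Z.
Proof.
rewrite /pencil exchange_big /=; apply: eq_bigr => L lL.
rewrite -[#|L|%:Z]natz -sum1_card natr_sum [RHS]big_mkcond /= big_mkcond /=.
apply: eq_bigr => i _; case iL: (i \in L); last by rewrite if_same.
by rewrite (subsetP (lineE lL)).
Qed.

Lemma beta_ground : beta (contract (restrict M E) set0)
  = 3 - 2 * #|E|%:Z + \sum_(L | line L) (#|L|%:Z - 1).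
Proof.
(* The coefficients are forced from the top down: corank 1 of a set spanning a line gives 1 on
   lines, and corank 2 of a point gives 2 - k_i on points. The value 3 at [set0] then determines
   [c0], through [sum_pencil]. *)
pose c (A : {set T}) : int :=
  if line A then 1 else 2 - \sum_(L | line L) (A \subset L)%:R.
have cL L : line L -> c L = 1 by rewrite /c => ->.
have ci i : c [set i] = 2 - pencil i.
  rewrite /c; case: ifP => [/(@line_point _ i)|_]; first by rewrite eqxx.
  by congr (_ - _); apply: eq_bigr => L _; rewrite sub1set.
have dec (g : {set T} -> int) : \sum_(F : pflat M) c (val F) * g (val F)
    = \sum_(i in E) (2 - pencil i) * g [set i] + \sum_(L | line L) g L.
  rewrite (sum_pflat (fun A => c A * g A)).
  congr (_ + _); apply: eq_bigr => A hA; first by rewrite ci.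
  by rewrite cL // mul1r.
rewrite (beta_minor (P := xpredT) (A := fun F : pflat M => val F)
   (c := fun F => c (val F))
   (c0 := 3 - 2 * #|E|%:Z + \sum_(L | line L) (#|L|%:Z - 1))) //.
- by rewrite -/(rank M) M_rank rk_set0 subn0 -signr_odd expr0 mul1r.
- by rewrite proper0 ground_neq0.
- by move=> F _; rewrite setD0; case/andP: (valP F) => /andP[].
- by move=> F _; case/and3P: (valP F).
move=> S; rewrite setD0 setU0 -/(rank M) M_rank => SE.
rewrite (dec (fun A => (S \subset A)%:R)).
case: (subset_cases S) SE => [->|[i ->]|[i [j [iS jS ij]]]] SE.
- under eq_bigr do rewrite sub0set mulr1.
  under [\sum_(L | line L) _]eq_bigr do rewrite sub0set mulr1n.
  rewrite eqxx rk_set0 mulr1 !sumrB sum_pencil sumr_const.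
  by rewrite -[2 *+ _]mulr_natr [#|E|%:R]natz; ring.
- rewrite sub1set in SE; rewrite -subset0 sub1set inE mulr0 addr0 rk_point //.
  rewrite (bigD1 i) //= subxx big1 => [|k /andP[_ ki]]; last first.
    by rewrite sub1set inE eq_sym (negbTE ki) mulr0.
  under eq_bigr do rewrite sub1set.
  by rewrite -/(pencil i) mulr1; ring.
- have -> : S == set0 = false by apply/eqP => S0; rewrite S0 inE in iS.
  rewrite (@sum_lines_above _ i j) // big1 ?add0r ?mulr0 ?addr0 // => k _.
  case: (boolP (S \subset [set k])) => [/subsetP Sk|_]; last by rewrite mulr0.
  have := Sk _ iS; have := Sk _ jS; rewrite !inE => /eqP jk /eqP ik.
  by rewrite ik jk eqxx in ij.
Qed.

End RankThree.

(** * The Chow ring in degree 2 *)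

Section ChowClass.
Variables (T : finType) (M : matroid T).

Lemma chow_class_is_zmod_morphism : zmod_morphism (@chow_class T M).
Proof. by move=> p q; rewrite /chow_class !piE. Qed.

Lemma chow_class_is_monoid_morphism : monoid_morphism (@chow_class T M).
Proof. by split=> [|p q]; rewrite /chow_class !piE. Qed.

HB.instance Definition _ := GRing.isZmodMorphism.Build (chow_poly M) (chow M)
  (@chow_class T M) chow_class_is_zmod_morphism.
HB.instance Definition _ := GRing.isMonoidMorphism.Build (chow_poly M) (chow M)
  (@chow_class T M) chow_class_is_monoid_morphism.

Lemma chow_class_eq0 (p : chow_poly M) : chow_class p = 0 <-> chow_ideal p.
Proof.
rewrite -[0](rmorph0 (@chow_class T M)) /chow_class.
by split=> [/eqmodP|h]; [|apply/eqmodP]; rewrite /= Quotient.equivE subr0.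
Qed.

Lemma chow_class_incomparable (F G : pflat M) : ~~ comparable_flats F G ->
  chow_class (xvar F) * chow_class (xvar G) = 0.
Proof.
move=> nFG; rewrite -rmorphM; apply/chow_class_eq0/asboolP.
exists (fun F' G' => ((F' == F) && (G' == G))%:R), (fun _ _ => 0).
rewrite [X in _ = _ + X]big1 ?addr0 => [|i _]; last first.
  by rewrite big1 // => j _; rewrite mul0r.
rewrite (bigD1 F) //= [X in _ + X]big1 ?addr0 => [|F' F'F]; last first.
  by rewrite big1 // => G' _; rewrite (negbTE F'F) mul0r.
rewrite (bigD1 G) //= !eqxx mul1r big1 ?addr0 // => G' /andP[_ G'G].
by rewrite (negbTE G'G) mul0r.
Qed.

Lemma chow_class_linear (i j : T) : i \in ground M -> j \in ground M ->
  \sum_(F : pflat M | i \in val F) chow_class (xvar F)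
    = \sum_(F : pflat M | j \in val F) chow_class (xvar F).
Proof.
move=> iE jE; apply/eqP; rewrite -subr_eq0 -!rmorph_sum -rmorphB; apply/eqP.
apply/chow_class_eq0/asboolP.
exists (fun _ _ => 0), (fun i' j' => ((i' == i) && (j' == j))%:R).
rewrite [X in _ = X + _]big1 ?add0r => [|F _]; last first.
  by rewrite big1 // => G _; rewrite mul0r.
rewrite (bigD1 i) //= [X in _ = _ + X]big1 ?addr0 => [|k /andP[_ ki]]; last first.
  by rewrite big1 // => k' _; rewrite (negbTE ki) mul0r.
rewrite (bigD1 j) //= !eqxx mul1r [X in _ = _ + X]big1 ?addr0 // => k /andP[_ kj].
by rewrite (negbTE kj) mul0r.
Qed.

(* [0] when [A] is not a nonempty proper flat. *)
Definition flat_class (A : {set T}) : chow M :=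
  oapp (fun F : pflat M => chow_class (xvar F)) 0 (insub A).

Lemma flat_class_val (F : pflat M) : flat_class (val F) = chow_class (xvar F).
Proof. by rewrite /flat_class valK. Qed.

Definition flat_combination (c : pflat M -> int) : chow M :=
  \sum_(F : pflat M) chow_class (xvar F) *~ c F.

Lemma chow_gr1P (a : chow M) :
  a \in chow_gr 1 <-> exists c, a = flat_combination c.
Proof.
split=> [/asboolP[p /dhomogP hp ->]|[c ->]]; last first.
  apply/asboolP; exists (\sum_(F : pflat M) xvar F *~ c F); last first.
    by rewrite rmorph_sum; apply: eq_bigr => F _; rewrite rmorphMz.
  apply: rpred_sum => F _; apply: rpredMz.
  by rewrite dhomogX /= mdeg1.
rewrite [p]mpolyE big_seq.
elim/big_ind: _ => [|q r [c qc] [d rd]|m /hp /eqP /mdeg1P[i /eqP ->]].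
- exists (fun=> 0); rewrite rmorph0; rewrite /flat_combination big1 //.
- exists (fun F => c F + d F); rewrite rmorphD /= qc rd -big_split /=.
  by apply: eq_bigr => F _; rewrite mulrzDr.
- exists (fun F => p@_U_(i) *+ (enum_rank F == i)).
  rewrite /flat_combination (bigD1 (enum_val i)) //= enum_valK eqxx mulr1n.
  rewrite big1 ?addr0 => [|F Fi]; last first.
    suff -> : (enum_rank F == i) = false by rewrite mulr0n mulr0z.
    by apply/negP => /eqP eF; rewrite -eF enum_rankK eqxx in Fi.
  by rewrite -[X in X *: _]intz scaler_int rmorphMz /xvar enum_valK.
Qed.

Lemma chow_gr2_ind (P : chow M -> Prop) :
  P 0 -> (forall a b, P a -> P b -> P (a + b)) ->
  (forall F G z, P ((chow_class (xvar F) * chow_class (xvar G)) *~ z)) ->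
  {in chow_gr 2, forall a, P a}.
Proof.
move=> P0 PD PFG _ /asboolP[p /dhomogP hp ->].
rewrite [p]mpolyE big_seq.
elim/big_ind: _ => [|q r|m /hp m2]; first by rewrite rmorph0.
  by rewrite rmorphD; exact: PD.
(* A monomial of degree 2 is split as one variable times a remainder of degree 1, which is again a
   variable. *)
have [i mi] : exists i, (U_(i) <= m)%MM.
  have : m != 0%MM by rewrite -mdeg_eq0 m2.
  case: (pickP (fun i => m i != 0%N)) => [i mi _|m0 /negP[]].
    by exists i; rewrite lep1mP.
  by apply/eqP/mnmP => i; rewrite mnm0E; apply/eqP/negPn; rewrite m0.
have md : mdeg m = 2%N by [].
have /eqP/mdeg1P[j /eqP mj] : mdeg (m - U_(i))%MM = 1%N.
  by have := md; rewrite -{1}(submK mi) mdegD mdeg1; lia.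
rewrite -(submK mi) mj mpolyXD -[X in X *: _]intz scaler_int rmorphMz rmorphM.
by have := PFG (enum_val j) (enum_val i); rewrite /xvar !enum_valK; exact.
Qed.

Lemma chow_gr2_mul (F G : pflat M) z :
  (chow_class (xvar F) * chow_class (xvar G)) *~ z \in chow_gr 2.
Proof.
apply/asboolP; exists ((xvar F * xvar G) *~ z); last by rewrite rmorphMz rmorphM.
by apply: rpredMz; rewrite -mpolyXD dhomogX /= mdegD !mdeg1.
Qed.

End ChowClass.

(** * Pairing quadratic forms with the Chow relations, and absence of torsion *)

Section SecondOrder.
Variables (T : finType) (M : matroid T) (B : pflat M -> pflat M -> int).
Hypothesis B_sym : forall F G, B F G = B G F.
Hypothesis B_incomparable : forall F G, ~~ comparable_flats F G -> B F G = 0.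
Hypothesis B_linear : forall F i j, i \in ground M -> j \in ground M ->
  \sum_(G : pflat M | i \in val G) B F G
    = \sum_(G : pflat M | j \in val G) B F G.

Local Notation ev := (meval (fun=> 0 : int)).

(* The apolar pairing of [p] with the quadratic form of [B]. *)
Definition apolar (p : chow_poly M) : int :=
  \sum_(F : pflat M) \sum_(G : pflat M)
    B F G * ev (p^`M(enum_rank F)^`M(enum_rank G)).

Lemma apolar_is_zmod_morphism : zmod_morphism apolar.
Proof.
move=> p q; rewrite /apolar -sumrB; apply: eq_bigr => F _.
by rewrite -sumrB; apply: eq_bigr => G _; rewrite !mderivB mevalB mulrBr.
Qed.

HB.instance Definition _ := GRing.isZmodMorphism.Build (chow_poly M) int
  apolar apolar_is_zmod_morphism.

Lemma mderiv_xvar (F G : pflat M) :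
  (xvar F)^`M(enum_rank G) = ((F == G)%:R)%:MP.
Proof.
rewrite /xvar mderivX mnm1E (inj_eq enum_rank_inj).
case: eqVneq => [->|_]; last by rewrite scale0r mpolyC0.
rewrite scale1r mpolyC1 -mpolyX0; congr mpolyX.
by apply/mnmP => i; rewrite mnmBE mnm0E subnn.
Qed.

Lemma sum_pick (F : pflat M) (f : pflat M -> int) :
  \sum_(G : pflat M) f G * (F == G)%:R = f F.
Proof.
rewrite (bigD1 F) //= eqxx mulr1 big1 ?addr0 // => G GF.
by rewrite eq_sym (negbTE GF) mulr0.
Qed.

(** By the Leibniz rule: [q] vanishes at the origin and its second derivatives are zero, so only the
    two mixed terms survive, and they agree by symmetry of [B]. *)
Lemma apolarM (p q : chow_poly M) (c : pflat M -> int) :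
  ev q = 0 -> (forall F, q^`M(enum_rank F) = (c F)%:MP) ->
  apolar (p * q) = 2 * \sum_(F : pflat M) \sum_(G : pflat M)
    B F G * (ev (p^`M(enum_rank F)) * c G).
Proof.
move=> q0 dq.
transitivity (\sum_(F : pflat M) \sum_(G : pflat M)
   (B F G * (ev (p^`M(enum_rank F)) * c G)
    + B F G * (ev (p^`M(enum_rank G)) * c F))).
  apply: eq_bigr => F _; apply: eq_bigr => G _.
  rewrite mderivM mderivD !mderivM !dq mderivC mulr0 addr0.
  by rewrite !mevalD !mevalM q0 !mevalC mulr0 add0r mulrDr.
under eq_bigr do rewrite big_split.
rewrite big_split /= [X in _ + X]exchange_big /=.
rewrite mulr_natl mulr2n; congr (_ + _).
by apply: eq_bigr => F _; apply: eq_bigr => G _; rewrite B_sym.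
Qed.

(** Two derivatives followed by evaluation at 0 see only the constant term of [p]; the factor 2
    comes from the two orders of differentiation. *)
Lemma apolar_xvar (p : chow_poly M) F G :
  apolar (p * (xvar F * xvar G)) = 2 * (ev p * B F G).
Proof.
rewrite mulrA (@apolarM _ _ (fun H => (G == H)%:R)).
- congr (_ * _).
  under eq_bigr => H _ do
    [under eq_bigr => K _ do rewrite mulrA; rewrite sum_pick].
  rewrite -[RHS](sum_pick F (fun H => ev p * B H G)).
  apply: eq_bigr => H _; rewrite mderivM mevalD !mevalM mderiv_xvar mevalC.
  by rewrite mevalXU mulr0 add0r; ring.
- exact: mevalXU.
- by move=> H; rewrite mderiv_xvar.
Qed.

(** The gradient of the relation is the difference of the indicators of the flats containing [i] and
    of those containing [j]; [B_linear] says that [B] annihilates it. *)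
Lemma apolar_linear (p : chow_poly M) i j : i \in ground M -> j \in ground M ->
  apolar (p * linear_rel M i j) = 0.
Proof.
move=> iE jE.
rewrite (@apolarM _ _ (fun H => (i \in val H)%:R - (j \in val H)%:R)).
- rewrite big1 ?mulr0 // => F _.
  have s k : \sum_(G : pflat M) B F G * (k \in val G)%:R
     = \sum_(G : pflat M | k \in val G) B F G.
    rewrite [RHS]big_mkcond; apply: eq_bigr => G _.
    by case: ifP; rewrite ?mulr0 ?mulr1.
  under eq_bigr do rewrite mulrCA mulrBr.
  by rewrite -mulr_sumr sumrB !s (B_linear F iE jE) subrr mulr0.
- rewrite mevalB 2!(raddf_sum ev).
  by rewrite !big1 ?subrr // => F _; exact: mevalXU.
- move=> F; rewrite mderivB 2!(raddf_sum (mderiv (enum_rank F))) /=.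
  have s k : \sum_(G : pflat M | k \in val G) (xvar G)^`M(enum_rank F)
     = ((k \in val F)%:R)%:MP.
    rewrite big_mkcond (bigD1 F) //= big1 ?addr0 => [|G GF].
      by rewrite mderiv_xvar eqxx; case: ifP.
    by rewrite mderiv_xvar (negbTE GF) mpolyC0 if_same.
  by rewrite !s raddfB.
Qed.

Lemma apolar_ideal (p : chow_poly M) : chow_ideal p -> apolar p = 0.
Proof.
move=> /asboolP[a [b ->]]; rewrite raddfD 2!(raddf_sum apolar) /= !big1 ?addr0 //.
  move=> i iE; rewrite (raddf_sum apolar) big1 // => j jE; exact: apolar_linear.
move=> F _; rewrite (raddf_sum apolar) big1 // => G nFG.
by rewrite /= apolar_xvar B_incomparable // !mulr0.
Qed.

(** The pairing vanishes on the ideal but takes the value 2 z B F G on this monomial. *)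
Lemma chow_mul_torsion_free F G (z : int) : B F G != 0 ->
  (chow_class (xvar F) * chow_class (xvar G)) *~ z = 0 -> z = 0.
Proof.
move=> BFG; rewrite -rmorphM -rmorphMz => /chow_class_eq0 /apolar_ideal /eqP.
rewrite -mulrzl apolar_xvar rmorph_int intz.
by rewrite !mulf_eq0 (negbTE BFG) orbF /= => /eqP.
Qed.

End SecondOrder.

(** * The degree map and the Chern numbers *)

Section ChernNumbers.
Variables (T : finType) (M : matroid T).
Hypotheses (M_simple : simple M) (M_rank : rank M = 3%N).
Local Notation E := (ground M).

(** * The intersection form on proper flats *)

Lemma sum_star (V : nmodType) (g : {set T} -> V) i : i \in E ->
  \sum_(F : pflat M | i \in val F) g (val F)
    = g [set i] + \sum_(L | line M L && (i \in L)) g L.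
Proof.
move=> iE; rewrite big_mkcond /=.
rewrite (sum_pflat M_simple M_rank (fun A => if i \in A then g A else 0)).
rewrite [in RHS]big_mkcondr; congr (_ + _).
rewrite (bigD1 i) //= inE eqxx big1 ?addr0 // => j /andP[_ ji].
by rewrite inE eq_sym (negbTE ji).
Qed.

Lemma pencilE i : pencil M i = \sum_(L | line M L && (i \in L)) 1.
Proof.
by rewrite /pencil [RHS]big_mkcondr /=; apply: eq_bigr => L _; case: ifP.
Qed.

(* The values of [deg (x_A * x_A')], forced by the relations of the Chow ring. *)
Definition flat_form (A A' : {set T}) : int :=
  if A == A' then
    if line M A then -1 else 1 - \sum_(L | line M L) (A \subset L)%:R
  else ((A \subset A') || (A' \subset A))%:R.

Lemma flat_form_sym A A' : flat_form A A' = flat_form A' A.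
Proof.
by rewrite /flat_form eq_sym; case: eqVneq => [->|_] //; rewrite orbC.
Qed.

Lemma flat_form_points i j :
  flat_form [set i] [set j] = if i == j then 1 - pencil M i else 0.
Proof.
rewrite /flat_form (inj_eq set1_inj); case: eqVneq => [->|ij].
  case: ifP => [/(@line_point _ _ _ j)|_]; first by rewrite eqxx.
  by congr (_ - _); apply: eq_bigr => L _; rewrite sub1set.
by rewrite !sub1set !inE [j == i]eq_sym (negbTE ij).
Qed.

Lemma flat_form_point_line i L : line M L ->
  flat_form [set i] L = (i \in L)%:R.
Proof.
move=> lL; rewrite /flat_form eq_sym (line_point i lL) sub1set.
by rewrite (line_subset_point i lL) orbF.
Qed.

Lemma line_subset L L' : line M L -> line M L' -> (L \subset L') = (L == L').
Proof.
move=> lL lL'; apply/idP/eqP => [LL'|-> //].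
have /set0Pn[i iL] := line_neq0 lL; have [j jL ji] := line_second_point i lL.
by apply: (line_eq M_simple lL lL' ji); rewrite ?(subsetP LL').
Qed.

Lemma flat_form_lines L L' : line M L -> line M L' ->
  flat_form L L' = if L == L' then -1 else 0.
Proof.
move=> lL lL'; rewrite /flat_form lL; case: eqVneq => // LL'.
by rewrite !line_subset // [L' == L]eq_sym (negbTE LL').
Qed.

(** The value does not depend on [i], which is the hypothesis [B_linear] for this form. A point
    other than [i] shares exactly one line with it; for the point [i] itself, 1 - k_i is completed
    by the k_i lines; on a line through [i] the self-intersection -1 cancels the flag. *)
Lemma flat_form_star F i : is_proper_flat M F -> i \in E ->
  \sum_(G : pflat M | i \in val G) flat_form F (val G) = (~~ line M F)%:R.
Proof.
move=> pF iE; rewrite (sum_star (flat_form F)) //.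
case: (proper_flatP M_simple M_rank pF) => [[h hE ->]|lF].
  have -> : line M [set h] = false.
    by apply/negP => /(@line_point _ _ _ h); rewrite eqxx.
  rewrite flat_form_points; case: eqVneq => [->|hi].
    rewrite pencilE [X in _ + X](eq_bigr (fun=> 1)) ?subrK // => L /andP[lL iL].
    by rewrite flat_form_point_line // iL.
  rewrite add0r -[RHS](sum_lines_pair M_simple M_rank hE iE hi).
  rewrite big_mkcondr; apply: eq_bigr => L lL.
  by rewrite flat_form_point_line // andbC; case: (i \in L).
rewrite lF flat_form_sym flat_form_point_line //.
rewrite (eq_bigr (fun L : {set T} => if F == L then -1 else 0)); last first.
  by move=> L /andP[lL _]; rewrite flat_form_lines.
rewrite big_mkcondr (bigD1 F) //= eqxx big1 ?addr0.
  by case: (i \in F); rewrite ?subrr ?addr0.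
by move=> L /andP[_ /negbTE LF]; rewrite eq_sym LF if_same.
Qed.

(** * Products of flat classes in degree 2 *)

Local Notation X := (flat_class M).

Lemma flat_class_incomparable A A' : is_proper_flat M A -> is_proper_flat M A' ->
  ~~ ((A \subset A') || (A' \subset A)) -> X A * X A' = 0.
Proof.
move=> pA pA' nAA'.
have := @chow_class_incomparable _ _ (exist _ A pA : pflat M) (exist _ A' pA').
by rewrite -!flat_class_val; exact.
Qed.

Lemma flat_class_points i j : i \in E -> j \in E -> i != j ->
  X [set i] * X [set j] = 0.
Proof.
move=> iE jE ij; rewrite flat_class_incomparable ?point_proper //.
by rewrite !sub1set !inE [j == i]eq_sym (negbTE ij).
Qed.

Lemma flat_class_point_line i L : i \in E -> line M L -> i \notin L ->
  X [set i] * X L = 0.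
Proof.
move=> iE lL iL; rewrite flat_class_incomparable ?point_proper ?line_proper //.
by rewrite sub1set (negbTE iL) (line_subset_point i lL).
Qed.

Lemma flat_class_lines L L' : line M L -> line M L' -> L != L' ->
  X L * X L' = 0.
Proof.
move=> lL lL' LL'; rewrite flat_class_incomparable ?line_proper //.
by rewrite !line_subset // [L' == L]eq_sym (negbTE LL').
Qed.

(** The class usually called alpha; the linear relations make it the same for all points [i]. *)
Definition star_class i : chow M :=
  X [set i] + \sum_(L | line M L && (i \in L)) X L.

Lemma star_class_eq i j : i \in E -> j \in E -> star_class i = star_class j.
Proof.
move=> iE jE; rewrite /star_class -!sum_star //.
under eq_bigr do rewrite flat_class_val.
under [RHS]eq_bigr do rewrite flat_class_val.
exact: chow_class_linear.
Qed.

(** Alpha is expanded at a second point [j] of [L]: among the flats containing [j], only [L] is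
    comparable with the point [i]. Hence the class of a flag does not depend on its line. *)
Lemma flat_class_flag i L : line M L -> i \in L ->
  X [set i] * X L = X [set i] * star_class i.
Proof.
move=> lL iL; have iE := subsetP (lineE lL) _ iL.
have [j jL ji] := line_second_point i lL; have jE := subsetP (lineE lL) _ jL.
rewrite (star_class_eq iE jE) mulrDr flat_class_points // 1?eq_sym // add0r.
rewrite mulr_sumr (bigD1 L) ?lL //= big1 ?addr0 // => L' /andP[/andP[lL' jL'] L'L].
apply: flat_class_point_line => //; apply: contra L'L => iL'.
by apply/eqP; exact: (line_eq M_simple lL' lL ji).
Qed.

(** Expanding alpha at a point off [L] shows that its product with [X L] is 0; expanding it at [i]
    gives the square of [X L] plus the class of the flag. *)
Lemma flat_class_line_sq L i : line M L -> i \in L ->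
  X L * X L = - (X [set i] * star_class i).
Proof.
move=> lL iL; have iE := subsetP (lineE lL) _ iL.
apply/eqP; rewrite -addr_eq0 -(flat_class_flag lL iL) (mulrC (X [set i])).
have [j jE jL] := line_point_off M_rank lL.
have <- : X L * star_class j = 0.
  rewrite mulrDr mulrC flat_class_point_line // add0r mulr_sumr big1 //.
  move=> L' /andP[lL' jL']; apply: flat_class_lines => //.
  by apply: contra jL => /eqP ->.
rewrite (star_class_eq jE iE) mulrDr addrC mulr_sumr (bigD1 L) ?lL //= big1 ?addr0 //.
by move=> L' /andP[/andP[lL' _] L'L]; apply: flat_class_lines; rewrite // eq_sym.
Qed.

(** Both sides are minus the square of the class of the line joining [i] and [j], so all flags have
    the same class. *)
Lemma flat_class_star i j : i \in E -> j \in E ->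
  X [set i] * star_class i = X [set j] * star_class j.
Proof.
move=> iE jE; have [->//|ij] := eqVneq i j.
have [L lL /andP[iL jL]] := line_join M_simple iE jE ij.
by apply: oppr_inj; rewrite -(flat_class_line_sq lL iL) -(flat_class_line_sq lL jL).
Qed.

Lemma flat_class_mul k A A' : k \in E ->
  is_proper_flat M A -> is_proper_flat M A' ->
  X A * X A' = (X [set k] * star_class k) *~ flat_form A A'.
Proof.
move=> kE; set mu := X [set k] * _.
have pl i L : i \in E -> line M L -> X [set i] * X L = mu *~ flat_form [set i] L.
  move=> iE lL; rewrite flat_form_point_line //; have [iL|iL] := boolP (i \in L).
    by rewrite flat_class_flag // /mu (flat_class_star kE iE).
  by rewrite flat_class_point_line.
move=> /(proper_flatP M_simple M_rank)[[i iE ->]|lA]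
       /(proper_flatP M_simple M_rank)[[j jE ->]|lA'].
- rewrite flat_form_points; case: eqVneq => [<-|ij]; last exact: flat_class_points.
  (* Solving the definition of alpha for the point class turns its square into one flag class minus
     k_i flag classes. *)
  have -> : X [set i] * X [set i] = X [set i] * star_class i
      - \sum_(L | line M L && (i \in L)) X [set i] * X L.
    by rewrite /star_class mulrDr mulr_sumr addrK.
  rewrite mulrzBr pencilE mulrz_sumr mulr1z /mu (flat_class_star kE iE).
  congr (_ - _); apply: eq_bigr => L /andP[lL iL].
  by rewrite flat_class_flag.
- exact: pl.
- by rewrite mulrC flat_form_sym pl.
- rewrite flat_form_lines //; case: eqVneq => [<-|AA']; last exact: flat_class_lines.
  have [i iA _] := line_second_point k lA.
  have iE := subsetP (lineE lA) _ iA.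
  by rewrite (flat_class_line_sq lA iA) /mu (flat_class_star kE iE) mulrN1z.
Qed.

(** * The degree map *)

Lemma fan_dimE : fan_dim M = 2%N.
Proof. by rewrite /fan_dim M_rank. Qed.

Lemma flag_exists : exists i L, line M L /\ i \in L.
Proof.
have /set0Pn[i iE] := ground_neq0 M_rank.
have : ~~ (E \subset [set i]).
  have := point_proper M_simple M_rank iE; case/and3P => _ _.
  by rewrite eqEsubset sub1set iE.
case/subsetPn => j jE; rewrite inE => ji.
by have [L lL /andP[_ iL]] := line_join M_simple jE iE ji; exists i, L.
Qed.

(** The class [mu] of a flag generates A^2 freely, so sending [mu *~ z] to [z] is a degree map. As
    [deg] is obtained by choice, both the existence of such a map and the uniqueness of its values
    on A^2 are needed. *)
Lemma deg_generator : exists2 mu : chow M,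
  (forall F G : pflat M, chow_class (xvar F) * chow_class (xvar G)
     = mu *~ flat_form (val F) (val G)) &
  (forall z, deg (mu *~ z) = z).
Proof.
have [i [L [lL iL]]] := flag_exists.
have iE := subsetP (lineE lL) _ iL.
pose mu := X [set i] * star_class i.
have mulE (F G : pflat M) : chow_class (xvar F) * chow_class (xvar G)
     = mu *~ flat_form (val F) (val G).
  by rewrite -!flat_class_val; apply: flat_class_mul; rewrite ?valP.
pose Fi : pflat M := exist _ [set i] (point_proper M_simple M_rank iE).
pose FL : pflat M := exist _ L (line_proper M_rank lL).
have formFL : flat_form (val Fi) (val FL) = 1.
  by rewrite flat_form_point_line // iL.
have muE : mu = chow_class (xvar Fi) * chow_class (xvar FL).
  by rewrite mulE formFL.
have mu_inj : injective (fun z => mu *~ z).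
  move=> z z' /eqP; rewrite -subr_eq0 -mulrzBr muE => /eqP h.
  apply/eqP; rewrite -subr_eq0; apply/eqP.
  apply: (@chow_mul_torsion_free _ _ (fun F G => flat_form (val F) (val G))
            _ _ _ Fi FL _ _ h) => [F G|F G|F j k jE kE|].
  - exact: flat_form_sym.
  - rewrite /comparable_flats /flat_form => nFG.
    by rewrite (negbTE nFG); case: eqP nFG => // ->; rewrite subxx.
  - by rewrite !flat_form_star ?valP.
  - by rewrite formFL.
have gr2 : {in chow_gr 2, forall a, exists z, a = mu *~ z}.
  apply: chow_gr2_ind => [|_ _ [z ->] [z' ->]|F G z].
  - by exists 0.
  - by exists (z + z'); rewrite mulrzDr.
  - by exists (flat_form (val F) (val G) * z); rewrite mulE mulrzA.
have gr2mu z : mu *~ z \in chow_gr 2 by rewrite muE chow_gr2_mul.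
(* A 2-dimensional cone is a pair of distinct comparable flats, on which the form equals 1. *)
have chain_mon (s : cone M 2) : chow_mon (val s) = mu.
  case/andP: (valP s) => /cards2P[F [G [FG ->]]] /forall_inP/(_ F).
  rewrite set21 => /(_ isT)/forall_inP/(_ G); rewrite set22 => /(_ isT) cFG.
  rewrite /chow_mon big_setU1 ?inE //= big_set1 rmorphM /= mulE /flat_form.
  by rewrite (inj_eq val_inj) (negbTE FG) -/(comparable_flats F G) cFG.
exists mu => // z.
(* A degree map is additive on the multiples of [mu] and equals 1 at [mu], which is the monomial of
   a maximal chain. *)
have deg_unique (f : chow M -> int) : is_degree_map f -> f (mu *~ z) = z.
  rewrite /is_degree_map fan_dimE => -[fD _ _ f1].
  have fmuD x y : f (mu *~ (x + y)) = f (mu *~ x) + f (mu *~ y).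
    by rewrite mulrzDr fD.
  have cFL : is_cone 2 [set Fi; FL].
    have nFL : Fi != FL by rewrite -(inj_eq val_inj) eq_sym (line_point i lL).
    rewrite /is_cone cards2 nFL /=; apply/forall_inP => F hF.
    apply/forall_inP => G hG; move: hF hG; rewrite /comparable_flats !inE.
    have iL' : [set i] \subset L by rewrite sub1set.
    by move=> /orP[]/eqP-> /orP[]/eqP-> /=; rewrite ?subxx ?iL' ?orbT.
  have fmu : f (mu *~ 1) = 1.
    by have := f1 (Sub [set Fi; FL] cFL : cone M 2); rewrite chain_mon mulr1z.
  have fmu0 : f (mu *~ 0) = 0 by have := fmuD 0 0; rewrite addr0; lia.
  elim/int_ind: z => // n IH; first by rewrite -addn1 PoszD fmuD fmu IH.
  have := fmuD (- n.+1%:Z) 1; rewrite fmu.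
  have -> : - n.+1%:Z + 1 = - n%:Z by rewrite -addn1 PoszD opprD addrNK.
  by rewrite IH => /eqP; rewrite -subr_eq => /eqP <-; rewrite -addn1 PoszD opprD.
apply: deg_unique; apply: classical_sets.xgetPex.
(* The witness inverts [z] to [mu *~ z]; the default 0 is taken only outside the multiples of [mu],
   that is, outside A^2. *)
pose f (a : chow M) : int := classical_sets.xget 0 (fun z => a = mu *~ z).
have fmu x : f (mu *~ x) = x.
  by apply: classical_sets.xget_unique => // y /mu_inj.
exists f; rewrite /is_degree_map fan_dimE; split.
- by move=> _ _ /gr2[x ->] /gr2[y ->]; rewrite -mulrzDr !fmu.
- by move=> _ _ /gr2[x ->] /gr2[y ->]; rewrite !fmu => ->.
- by move=> x; exists (mu *~ x).
- by move=> s; rewrite chain_mon -[mu]mulr1z fmu.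
Qed.

Lemma deg_mul (c d : pflat M -> int) :
  deg (flat_combination c * flat_combination d)
    = \sum_(F : pflat M) c F * \sum_(G : pflat M) d G * flat_form (val F) (val G).
Proof.
have [mu mulE degmu] := deg_generator; rewrite -[RHS]degmu; congr deg.
rewrite mulrz_sumr mulr_suml; apply: eq_bigr => F _.
rewrite mulrzA mulrz_sumr mulr_sumr; apply: eq_bigr => G _.
rewrite mulrzAl mulrzAr mulE -!mulrzA; congr (_ *~ _); ring.
Qed.

(** * Weights on rays and the CSM cycles *)

Lemma chow_mon1 (G : pflat M) :
  chow_mon [set G] = flat_combination (fun F => (F == G)%:R).
Proof.
rewrite /chow_mon big_set1 /flat_combination (bigD1 G) //= eqxx mulr1z.
by rewrite big1 ?addr0 // => F /negbTE ->; rewrite mulr0z.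
Qed.

Lemma chow_weight1 (c : pflat M -> int) (s : cone M 1) G : val s = [set G] ->
  chow_weight 1 (flat_combination c) s
    = \sum_(F : pflat M) c F * flat_form (val F) (val G).
Proof.
move=> sG; rewrite ffunE sG chow_mon1 deg_mul; apply: eq_bigr => F _.
congr (_ * _); rewrite (bigD1 G) //= eqxx mul1r big1 ?addr0 // => H /negbTE ->.
by rewrite mul0r.
Qed.

Lemma is_cone1 (F : pflat M) : is_cone 1 [set F].
Proof.
rewrite /is_cone cards1; apply/forall_inP => G; rewrite inE => /eqP ->.
by apply/forall_inP => H; rewrite inE => /eqP ->; rewrite /comparable_flats subxx.
Qed.

Definition ray (F : pflat M) : cone M 1 := exist _ [set F] (is_cone1 F).

Lemma cone1P (s : cone M 1) : exists F, s = ray F.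
Proof.
case/andP: (valP s) => /cards1P[F sF] _.
by exists F; apply: val_inj; rewrite sF.
Qed.

(** The weight of [csm] on the ray of [A]: minus the product of two beta invariants, one of which is
    1. For a point the sum is k_i. It is defined on sets so that [sum_pflat] and [sum_star]
    apply. *)
Definition csm_value (A : {set T}) : int :=
  if line M A then 2 - #|A|%:Z else 2 - \sum_(L | line M L) (A \subset L)%:R.

Lemma csm_value_line L : line M L -> csm_value L = 2 - #|L|%:Z.
Proof. by rewrite /csm_value => ->. Qed.

Lemma csm_value_point i : csm_value [set i] = 2 - pencil M i.
Proof.
rewrite /csm_value; case: ifP => [/(line_point i)|_]; first by rewrite eqxx.
by congr (_ - _); apply: eq_bigr => L _; rewrite sub1set.
Qed.

Lemma csm_weight_ray F : csm_weight M 1 (ray F) = csm_value (val F).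
Proof.
rewrite ffunE fan_dimE expr1 /chain_seq /= enum_set1 /= !big_cons big_nil /=.
case: (proper_flatP M_simple M_rank (valP F)) => [[i iE eF]|lF].
  move: eF => /= ->.
  by rewrite beta_point // beta_contract_point // csm_value_point; ring.
by rewrite beta_line // beta_contract_line // csm_value_line //; ring.
Qed.

Lemma csm_weight_vertex :
  csm_weight M 0 (vertex M) = beta (contract (restrict M E) set0).
Proof.
rewrite ffunE fan_dimE /chain_seq enum_set0 /= big_cons big_nil /=.
by rewrite mulr1 expr2 mulrNN !mul1r.
Qed.

(** The lines through [i], with [i] removed, partition the other points. *)
Lemma sum_line_card i : i \in E ->
  \sum_(L | line M L && (i \in L)) (#|L|%:Z - 1) = #|E|%:Z - 1.
Proof.
move=> iE; rewrite sumrB -pencilE.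
have -> : \sum_(L | line M L && (i \in L)) #|L|%:Z
    = \sum_(j in E) \sum_(L | line M L) ((i \in L) && (j \in L))%:R.
  rewrite exchange_big /= big_mkcondr /=; apply: eq_bigr => L lL.
  case: (i \in L) => /=; last by rewrite big1.
  rewrite -[LHS]natz -sum1_card natr_sum big_mkcond /= [RHS]big_mkcond /=.
  apply: eq_bigr => j _; case jL: (j \in L); last by rewrite if_same.
  by rewrite (subsetP (lineE lL)).
rewrite (bigD1 i) //= [X in X + _ - _](_ : _ = pencil M i); last first.
  by rewrite /pencil; apply: eq_bigr => L _; rewrite andbb.
rewrite (eq_bigr (fun=> 1)); last first.
  by move=> j /andP[jE ji]; rewrite sum_lines_pair // eq_sym.
rewrite (eq_bigl (mem (E :\ i))) => [|j]; last by rewrite !inE andbC.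
by rewrite sumr_const natz (cardsD1 i E) iE PoszD; lia.
Qed.

Lemma csm_value_star i : i \in E ->
  \sum_(F : pflat M | i \in val F) csm_value (val F) = 3 - #|E|%:Z.
Proof.
move=> iE; rewrite (sum_star csm_value) // csm_value_point pencilE.
rewrite [X in _ + X](eq_bigr (fun L : {set T} => 1 - (#|L|%:Z - 1))); last first.
  by move=> L /andP[lL _]; rewrite csm_value_line //; ring.
by rewrite sumrB sum_line_card //; ring.
Qed.

Lemma balanced0 (w : {ffun cone M 0 -> int}) : balanced w.
Proof. by apply/forallP => C. Qed.

(** Balancing is required only at the vertex, whose span is the line of [uvec E]. The coordinate of
    the boundary at a point [e] is the star sum of [csm_value_star], which is the same for every
    [e]. *)
Lemma csm_weight1_balanced : balanced (csm_weight M 1).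
Proof.
apply/forallP => C; apply/implyP => /= /andP[/eqP/cards0_eq -> _].
suff -> : boundary (csm_weight M 1) set0
    = (3 - #|E|%:Z)%:~R *: uvec E.
  by apply: subvP (addvSr _ _) _ _; rewrite memvZ ?memv_line.
rewrite /boundary (eq_bigr (fun F => (csm_value (val F))%:~R *: uvec (val F))).
  apply/ffunP => e; rewrite sum_ffunE !ffunE.
  have [eE|eE] := boolP (e \in E).
    rewrite -(csm_value_star eE) [in RHS]rmorph_sum scaler_suml [RHS]big_mkcond /=.
    apply: eq_bigr => F _; rewrite !ffunE; case: ifP => // _.
    exact: mulr0.
  rewrite scaler0 big1 // => F _; rewrite !ffunE.
  suff -> : e \in val F = false by exact: mulr0.
  case/and3P: (valP F) => /andP[/subsetP FE _] _ _.
  by apply: contraNF eE => /FE.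
move=> F _; rewrite (big_pred1 (ray F)) ?csm_weight_ray // => s.
by rewrite setU0 -(inj_eq val_inj).
Qed.

Lemma weight_csm k : balanced (csm_weight M k) -> weight (csm M k) = csm_weight M k.
Proof. by move=> h; exact: (insubdK (0 : MW M k) h). Qed.

(** * Evaluation of the Chern numbers *)

Lemma chern_c2E :
  chern_c2 M = 3 - 2 * #|E|%:Z + \sum_(L | line M L) (#|L|%:Z - 1).
Proof.
rewrite /chern_c2 /mw_value weight_csm ?balanced0 // csm_weight_vertex.
exact: beta_ground.
Qed.

(* Any class of the weight will do: the pairing of two classes is determined by
   the weight of either of them. *)
Lemma chern_c1_sqE (c : pflat M -> int) :
  (forall G : pflat M, \sum_(F : pflat M) c F * flat_form (val F) (val G)
     = csm_value (val G)) ->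
  chern_c1_sq M = \sum_(F : pflat M) c F * csm_value (val F).
Proof.
move=> cE; rewrite /chern_c1_sq /mw_mul /mw_value.
rewrite (insubdK (0 : MW M 0) (balanced0 _)).
(* Existence of one class with the right weight ensures that [mw_class] has it too, instead of being
   the default 0. The chosen class is then known only through some coefficients [d]. *)
have : exists a : chow M, a \in chow_gr (fan_dim M - 1) /\
    chow_weight 1 a = weight (csm M 1).
  exists (flat_combination c); split.
    by rewrite fan_dimE; apply/chow_gr1P; exists c.
  rewrite weight_csm; last exact: csm_weight1_balanced.
  by apply/ffunP => s; have [G ->] := cone1P s;
    rewrite (@chow_weight1 _ _ G) // csm_weight_ray.
move/(classical_sets.xgetPex 0); rewrite -/(mw_class (csm M 1)).
move: (mw_class (csm M 1)) => a [].
rewrite fan_dimE => /chow_gr1P[d ->].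
rewrite weight_csm; last exact: csm_weight1_balanced.
move=> /ffunP dE.
have dE' (G : pflat M) :
    \sum_(F : pflat M) d F * flat_form (val F) (val G) = csm_value (val G).
  by rewrite -csm_weight_ray -dE (@chow_weight1 _ _ G).
rewrite ffunE /chow_mon big_set0 rmorph1 mulr1 deg_mul.
(* By symmetry of the form, the pairing of [d] with itself is that of [d] with [c], and then that of
   [c] with the weight. *)
under eq_bigr => F _ do
  [under eq_bigr => G _ do rewrite flat_form_sym; rewrite dE' -cE mulr_sumr].
rewrite exchange_big /=; apply: eq_bigr => F _.
by rewrite -dE' mulr_sumr; apply: eq_bigr => G _; rewrite flat_form_sym; ring.
Qed.

(** Lines are grouped by size; every size lies between 2 and |E|, so the range misses none. *)
Lemma sum_lines_num_lines (g : nat -> int) :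
  \sum_(2 <= m < #|E|.+1) g m * (num_lines M m)%:Z = \sum_(L | line M L) g #|L|.
Proof.
have numE m : (num_lines M m)%:Z = \sum_(L | line M L) (#|L| == m)%:R.
  rewrite -[LHS]natz /num_lines -sum1_card natr_sum big_mkcond [RHS]big_mkcond /=.
  apply: eq_bigr => L _; rewrite inE andbA -/(line M L).
  by case: (line M L) => //=; case: (_ == m).
under eq_bigr do rewrite numE mulr_sumr.
rewrite exchange_big /=; apply: eq_bigr => L lL.
rewrite (bigD1_seq #|L|) /= ?iota_uniq //; last first.
  by rewrite mem_index_iota (line_card lL) /= ltnS subset_leq_card ?(lineE lL).
rewrite eqxx mulr1 big1 ?addr0 // => m /negbTE mL.
by rewrite eq_sym mL mulr0.
Qed.

Lemma chern_c1_sq_lines : chern_c1_sq M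
  = 9 - 5 * #|E|%:Z + \sum_(L | line M L) (3 * #|L|%:Z - 4).
Proof.
have /set0Pn[e eE] := ground_neq0 M_rank.
pose n : int := #|E|%:Z.
(* The first summand already pairs to 2 - |L| with each line, but to 2n - 1 - k_h with a point [h].
   The star of [e] pairs to 1 with points and 0 with lines, so 3 - 2n times it corrects the points
   alone. *)
pose c (A : {set T}) : int := (if line M A then 2 * (#|A|%:Z - 1) else 1)
  + (3 - 2 * n) * (e \in A)%:R.
have sum_c (g : {set T} -> int) : \sum_(F : pflat M) c (val F) * g (val F)
    = \sum_(i in E) g [set i] + \sum_(L | line M L) 2 * (#|L|%:Z - 1) * g L
      + (3 - 2 * n) * \sum_(F : pflat M | e \in val F) g (val F).
  rewrite [X in _ = _ + _ * X]big_mkcond mulr_sumr.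
  rewrite (eq_bigr (fun F : pflat M =>
    (if line M (val F) then 2 * (#|val F|%:Z - 1) else 1) * g (val F)
    + (3 - 2 * n) * (if e \in val F then g (val F) else 0))); last first.
    by move=> F _; rewrite /c; case: (e \in _) => /=; rewrite ?mulr1 ?mulr0; ring.
  rewrite big_split /=; congr (_ + _).
  rewrite (sum_pflat M_simple M_rank
    (fun A => (if line M A then 2 * (#|A|%:Z - 1) else 1) * g A)).
  congr (_ + _); last by apply: eq_bigr => L ->.
  apply: eq_bigr => i _.
  by case: ifP => [/(line_point i)|_]; rewrite ?eqxx ?mul1r.
rewrite (@chern_c1_sqE (fun F => c (val F))).
- rewrite (sum_c csm_value) csm_value_star //.
  under eq_bigr do rewrite csm_value_point.
  under [X in _ + X + _]eq_bigr => L lL do rewrite csm_value_line //.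
  (* Every ordered pair of distinct points lies on exactly one line. *)
  have pairs : \sum_(L | line M L) #|L|%:Z * (#|L|%:Z - 1) = n * (n - 1).
    transitivity (\sum_(i in E) \sum_(L | line M L && (i \in L)) (#|L|%:Z - 1)).
      under [RHS]eq_bigr do rewrite big_mkcondr.
      rewrite exchange_big /=; apply: eq_bigr => L lL.
      rewrite -big_mkcondr (eq_bigl (mem L)) => [|i].
        by rewrite sumr_const -[RHS]mulr_natl natz.
      rewrite /=; case iL: (i \in L); rewrite ?andbF //.
      by rewrite (subsetP (lineE lL)).
    under eq_bigr => i iE do rewrite sum_line_card //.
    by rewrite sumr_const -[LHS]mulr_natl natz.
  rewrite sumrB sum_pencil sumr_const -[2 *+ _]mulr_natl natz -/n.
  (* The quadratic part is isolated so that [pairs] evaluates it; the linear sum of the |L| cancels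
     the one coming from the points. *)
  rewrite [X in _ + X + _](_ : _ = \sum_(L | line M L) (3 * #|L|%:Z - 4)
    + \sum_(L | line M L) #|L|%:Z
    - 2 * \sum_(L | line M L) #|L|%:Z * (#|L|%:Z - 1)).
    by rewrite pairs; ring.
  rewrite mulr_sumr -big_split -sumrB /=; apply: eq_bigr => L _; ring.
- move=> G; rewrite (sum_c (fun A => flat_form A (val G))).
  under [X in _ + _ * X]eq_bigr do rewrite flat_form_sym.
  rewrite flat_form_star ?valP //.
  case: (proper_flatP M_simple M_rank (valP G)) => [[h hE ->]|lG].
    rewrite csm_value_point.
    have -> : line M [set h] = false.
      by apply/negP => /(line_point h); rewrite eqxx.
    rewrite (bigD1 h) //= flat_form_points eqxx big1 ?addr0; last first.
      by move=> i /andP[_ /negbTE ih]; rewrite flat_form_points ih.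
    rewrite (eq_bigr (fun L : {set T} =>
      2 * (if h \in L then #|L|%:Z - 1 else 0))); last first.
      move=> L lL; rewrite flat_form_sym flat_form_point_line //.
      by case: (h \in L); rewrite ?mulr1 ?mulr0.
    by rewrite -mulr_sumr -big_mkcondr sum_line_card // -/n; ring.
  rewrite lG csm_value_line // mulr0 addr0.
  under eq_bigr => i _ do rewrite flat_form_point_line //.
  have -> : \sum_(i in E) (i \in val G)%:R = #|val G|%:Z.
    rewrite -[RHS]natz -sum1_card natr_sum big_mkcond /= [RHS]big_mkcond /=.
    apply: eq_bigr => j _; case jL: (j \in sval G); last by rewrite if_same.
    by rewrite (subsetP (lineE lG)).
  rewrite (bigD1 (val G)) //= flat_form_lines // eqxx big1 ?addr0.
    by ring.
  by move=> L /andP[lL /negbTE LG]; rewrite flat_form_lines // LG mulr0.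
Qed.

End ChernNumbers.

(* Rank 2 flats have size at most n, so the sums over m >= 2 stop at n. *)
Theorem proposition3p1 (T : finType) (M : matroid T) (n : nat)
    (M_simple : simple M) (M_rank : rank M = 3%N) (M_size : #|ground M| = n) :
  chern_c1_sq M
    = 9 - 5 * n%:Z
      + \sum_(2 <= m < n.+1) (3 * m%:Z - 4) * (num_lines M m)%:Z
  /\
  chern_c2 M
    = 3 - 2 * n%:Z
      + \sum_(2 <= m < n.+1) (m%:Z - 1) * (num_lines M m)%:Z.
Proof.
rewrite -M_size (sum_lines_num_lines M (fun m => 3 * m%:Z - 4)).
rewrite (sum_lines_num_lines M (fun m => m%:Z - 1)).
by rewrite chern_c1_sq_lines // chern_c2E.
Qed.
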